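(* Consider problem (P) of the context (no state constraints), with the constraint at infinity being either of free-endpoint or of mixed-endpoint type as defined there. Let $(x_*(\cdot),u_*(\cdot))\in\mathscr{A}_{adm}\cap\mathscr{A}_{Lip}\cap\mathscr{A}_{lim}$ be a strong local minimizer in (P), and let $p(\cdot):\mathbb{R}_+\to\mathbb{R}^n$ be an adjoint function satisfying, together with multipliers $\lambda_0\ge0$, $l_0$, $l_1$ (with $\lambda_0,l_0,l_1,p$ not all zero), the maximum principle (M) of the context. (a) If the problem has free endpoint, then $$\lim_{t\to\infty}p(t)=0,\qquad \lim_{t\to\infty}\langle p(t),x(t)\rangle=0\quad\text{for all }x(\cdot)\in W^1_\infty(\mathbb{R}_+,\mathbb{R}^n).$$ (b) If the problem has mixed endpoint, then $$\lim_{t\to\infty}\langle p(t),x(t)-x_*(t)\rangle=0\quad\text{for all admissible }x(\cdot)\in W^1_\infty(\mathbb{R}_+,\mathbb{R}^n).$$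
   Context: Notation: $\mathbb{R}_+=[0,\infty)$, $\overline{\mathbb{R}}_+=[0,\infty]$. $W^1_\infty(\mathbb{R}_+,\mathbb{R}^n)$ is the space of bounded, locally absolutely continuous functions with essentially bounded derivative; $L_\infty(\mathbb{R}_+,U)$ is the set of essentially bounded measurable functions with values in $U$. Data: $\omega\in L_1(\mathbb{R}_+,\mathbb{R})$, $\|\omega\|_{L_1}>0$; $f:\mathbb{R}\times\mathbb{R}^n\times\mathbb{R}^m\to\mathbb{R}$, $\varphi:\mathbb{R}\times\mathbb{R}^n\times\mathbb{R}^m\to\mathbb{R}^n$, $h_0:\mathbb{R}^n\to\mathbb{R}^{s_0}$, $h_1:\mathbb{R}\times\mathbb{R}^n\to\mathbb{R}^{s_1}$; $\emptyset\ne U\subseteq\mathbb{R}^m$. Problem (P): minimize $J(x,u)=\int_0^\infty\omega(t)f(t,x(t),u(t))\,dt$ subject to $\dot x(t)=\varphi(t,x(t),u(t))$ (Carathéodory sense), $h_0(x(0))=0$, $\lim_{t\to\infty}h_1(t,x(t))=0$, $u(t)\in U$. Endpoint types. Free endpoint: $\lim_{t\to\infty}x(t)$ is free, i.e. there is no condition at infinity (no $h_1$, no $l_1$; the term $h_{1x}^Tl_1$ is $0$). Mixed endpoint: for some $k\in\{0,\dots,n\}$, $\lim_{t\to\infty}x^i(t)$ is free for $i=1,\dots,k$ and $\lim_{t\to\infty}x^i(t)=x_1^i$ with fixed numbers $x_1^i$ for $i=k+1,\dots,n$, i.e. $h_1(t,x)=(x^i-x^i_1)_{i=k+1,\dots,n}$.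 $\mathscr{A}_{adm}$: all $(x,u)\in W^1_\infty(\mathbb{R}_+,\mathbb{R}^n)\times L_\infty(\mathbb{R}_+,U)$ satisfying all constraints of (P) with $J$ finite; ''admissible $x(\cdot)$'' means $(x,u)\in\mathscr{A}_{adm}$ for some $u$. $\mathscr{A}_{Lip}$: all $(x,u)\in W^1_\infty\times L_\infty(\mathbb{R}_+,U)$ such that for every compact $U_1\subset\mathbb{R}^m$ there is $\gamma>0$ such that $f,\varphi,h_0,h_1$ are uniformly continuous in all variables and uniformly continuously differentiable in $x$ on $V_\gamma\times U_1$, $V_\gamma=\{(t,y)\in\overline{\mathbb{R}}_+\times\mathbb{R}^n\mid\|y-x(t)\|\le\gamma\}$ (values at $t=\infty$ are limits as $t\to\infty$, whose existence is included). $\mathscr{A}_{lim}$: all $(x,u)\in W^1_\infty\times L_\infty(\mathbb{R}_+,U)$ such that $\int_0^\infty\|\varphi(t,x(t),u(t))\|dt<\infty$, $\int_0^\infty\|\varphi_x(t,x(t),u(t))\|dt<\infty$, and, for some $\gamma>0$: for every $\delta>0$ there is $T>0$ with $\int_T^\infty\|\varphi(t,\xi(t),u(t))-\varphi(t,\xi'(t),u(t))-\varphi_x(t,x(t),u(t))(\xi(t)-\xi'(t))\|dt\le\delta\|\xi-\xi'\|_\infty$ for all $\xi,\xi'\in W^1_\infty(\mathbb{R}_+,\mathbb{R}^n)$ within sup-distance $\gamma$ of $x$. Strong local minimizer: admissible $(x_*,u_* )$ such that for some $\varepsilon>0$, $J(x,u)\ge J(x_*,u_* )$ for all $(x,u)\in\mathscr{A}_{adm}$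 with $\|x-x_*\|_\infty\le\varepsilon$. Maximum principle (M), with $H(t,x,u,p,\lambda_0)=-\lambda_0\omega(t)f(t,x,u)+\langle p,\varphi(t,x,u)\rangle$: $p$ is locally absolutely continuous; for a.e. $t$, $\dot p(t)=-\varphi_x^T(t,x_*(t),u_*(t))p(t)+\lambda_0\omega(t)f_x(t,x_*(t),u_*(t))$; $p(0)={h_0'}^T(x_*(0))l_0$, $\lim_{t\to\infty}p(t)=-\lim_{t\to\infty}h_{1x}^T(t,x_*(t))l_1$; and for a.e. $t$, $H(t,x_*(t),u_*(t),p(t),\lambda_0)=\max_{u\in U}H(t,x_*(t),u,p(t),\lambda_0)$. *)

(* Defs.v *)
From mathcomp Require Import all_boot all_order all_algebra.
From mathcomp Require Import all_classical all_reals all_analysis.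

Set Implicit Arguments.
Unset Strict Implicit.
Unset Printing Implicit Defensive.

Import Order.TTheory GRing.Theory Num.Theory.
Import numFieldNormedType.Exports.

Local Open Scope classical_set_scope.
Local Open Scope ring_scope.

(* Vectors of R^n are row vectors, normed by the library's maximum norm; every
   notion below is invariant under passing to an equivalent norm.
   Functions of time are total functions on R of which only the values on
   [0, +oo[ matter. *)

Definition half_line (R : realType) : set R := `[0, +oo[%classic.
Arguments half_line : clear implicits.

(* Measurability is Lebesgue (not Borel) measurability: R carries the
   sigma-algebra on which the completed Lebesgue measure is defined. *)
Definition lebesgueType (R : realType) :=
  caratheodory_type (@wlength R idfun)^*%mu.

Notation mu := completed_lebesgue_measure.

Definition ae_half_line (R : realType) (Q : R -> Prop) : Prop :=
  {ae mu, forall t : R, 0 <= t -> Q t}.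

Definition inner (R : realType) (n : nat) (v w : 'rV[R]_n) : R :=
  \sum_(i < n) v 0 i * w 0 i.

(* The library's 'J is the transpose of the usual Jacobian matrix: it acts on
   row vectors by multiplication on the right.  Here [jac g y] is the usual
   matrix, with entry (i, j) the derivative of g_i in y_j.  For row vectors,
   A^T v is then written v *m A, and A v is written v *m A^T. *)
Definition jac (R : realType) (n k : nat) (g : 'rV[R]_n -> 'rV[R]_k)
    (y : 'rV[R]_n) : 'M[R]_(k, n) := ('J g y)^T.

(* A scalar regarded as a vector of R^1. *)
Definition vec1 (R : realType) (c : R) : 'rV[R]_1 := const_mx c.

Definition abs_cont_on (R : realType) (V : normedModType R) (a b : R)
    (g : R -> V) : Prop :=
  forall e : R, 0 < e -> exists2 d : R, 0 < d &
    forall (N : nat) (l r : 'I_N -> R),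
      (forall i, a <= l i /\ l i <= r i /\ r i <= b) ->
      trivIset setT (fun i => `]l i, r i[%classic) ->
      \sum_(i < N) (r i - l i) < d ->
      \sum_(i < N) `|g (r i) - g (l i)| < e.

Definition loc_abs_cont (R : realType) (V : normedModType R) (g : R -> V)
    : Prop :=
  forall T : R, 0 < T -> abs_cont_on 0 T g.

Definition W1inf (R : realType) (n : nat) (x : R -> 'rV[R]_n) : Prop :=
  [/\ exists M : R, forall t, 0 <= t -> `|x t| <= M,
      loc_abs_cont x
    & exists M : R,
        ae_half_line (fun t => derivable x t 1 /\ `|'D_1 x t| <= M)].

Definition Linf (R : realType) (m : nat) (U : set 'rV[R]_m)
    (u : R -> 'rV[R]_m) : Prop :=
  [/\ forall i : 'I_m,
        measurable_fun (half_line R : set (lebesgueType R)) (fun t => u t 0 i),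
      exists M : R, ae_half_line (fun t => `|u t| <= M)
    & forall t, 0 <= t -> U (u t)].

Definition sup_norm (R : realType) (n : nat) (x : R -> 'rV[R]_n) : R :=
  sup [set `|x t| | t in half_line R].

Record control_problem (R : realType) (n m s0 s1 : nat) := ControlProblem {
  omega : R -> R ;
  cost : R -> 'rV[R]_n -> 'rV[R]_m -> R ;
  phi : R -> 'rV[R]_n -> 'rV[R]_m -> 'rV[R]_n ;
  h0 : 'rV[R]_n -> 'rV[R]_s0 ;
  h1 : R -> 'rV[R]_n -> 'rV[R]_s1 ;
  U : set 'rV[R]_m
}.

Section Problem.
Context (R : realType) (n m s0 s1 : nat).
Variable P : control_problem R n m s0 s1.

Definition cost_x (t : R) (y : 'rV[R]_n) (v : 'rV[R]_m) : 'rV[R]_n :=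
  jac (fun z => vec1 (cost P t z v)) y.

Definition phi_x (t : R) (y : 'rV[R]_n) (v : 'rV[R]_m) : 'M[R]_n :=
  jac (fun z => phi P t z v) y.

Definition h1_x (t : R) (y : 'rV[R]_n) : 'M[R]_(s1, n) := jac (h1 P t) y.

Definition J (x : R -> 'rV[R]_n) (u : R -> 'rV[R]_m) : \bar R :=
  (\int[mu]_(t in half_line R) (omega P t * cost P t (x t) (u t))%:E)%E.

(* J is finite exactly when its integrand is Lebesgue integrable. *)
Definition J_finite (x : R -> 'rV[R]_n) (u : R -> 'rV[R]_m) : Prop :=
  mu.-integrable (half_line R)
    (fun t => (omega P t * cost P t (x t) (u t))%:E).

Definition A_adm (x : R -> 'rV[R]_n) (u : R -> 'rV[R]_m) : Prop :=
  [/\ W1inf x /\ Linf (U P) u,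
      ae_half_line (fun t => is_derive t (1 : R) x (phi P t (x t) (u t))),
      h0 P (x 0) = 0,
      h1 P t (x t) @[t --> +oo] --> (0 : 'rV[R]_s1)
    & J_finite x u].

Definition strong_local_minimizer (x : R -> 'rV[R]_n) (u : R -> 'rV[R]_m)
    : Prop :=
  A_adm x u /\
  exists2 e : R, 0 < e &
    forall x' u', A_adm x' u' -> (forall t, 0 <= t -> `|x' t - x t| <= e) ->
      (J x u <= J x' u')%E.

End Problem.

(* Extension of a function of time to [0, +oo], by its limit at +oo. *)
Definition ext_oo (R : realType) (T : ptopologicalType) (g : R -> T)
    (t : \bar R) : T :=
  if t is r%:E then g r else lim (g s @[s --> +oo]).

(* V_gamma * U1, the times ranging over [0, +oo]. *)
Definition tube (R : realType) (n m : nat) (x : R -> 'rV[R]_n) (gamma : R)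
    (U1 : set 'rV[R]_m) : set (\bar R * 'rV[R]_n * 'rV[R]_m) :=
  [set z | [/\ (0 <= z.1.1)%E, `|z.1.2 - ext_oo x z.1.1| <= gamma & U1 z.2]].

(* Uniform continuity is with respect to the library's uniform structure of
   \bar R, i.e. that of the compactification of the time axis.  The derivative
   at time +oo is the derivative of the limit function; as it is required to be
   continuous up to +oo, it is also the limit of the derivatives. *)
Definition unif_C1_on_tube (R : realType) (n m k : nat) (x : R -> 'rV[R]_n)
    (gamma : R) (U1 : set 'rV[R]_m)
    (g : R -> 'rV[R]_n -> 'rV[R]_m -> 'rV[R]_k) : Prop :=
  let V := tube x gamma U1 in
  let gbar := fun (t : \bar R) y v => ext_oo (fun s => g s y v) t in
  [/\ forall y v, V (+oo%E, y, v) -> cvg (g s y v @[s --> +oo]),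
      unif_continuous (fun z : subspace V => gbar z.1.1 z.1.2 z.2),
      forall z, V z -> differentiable (fun y => gbar z.1.1 y z.2) z.1.2
    & unif_continuous
        (fun z : subspace V => jac (fun y => gbar z.1.1 y z.2) z.1.2)].

Section Classes.
Context (R : realType) (n m s0 s1 : nat).
Variable P : control_problem R n m s0 s1.

Definition A_Lip (x : R -> 'rV[R]_n) (u : R -> 'rV[R]_m) : Prop :=
  [/\ W1inf x, Linf (U P) u, cvg (x t @[t --> +oo])
    & forall U1 : set 'rV[R]_m, compact U1 -> exists2 gamma : R, 0 < gamma &
        [/\ unif_C1_on_tube x gamma U1 (fun t y v => vec1 (cost P t y v)),
            unif_C1_on_tube x gamma U1 (phi P),
            unif_C1_on_tube x gamma U1 (fun _ y _ => h0 P y)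
          & unif_C1_on_tube x gamma U1 (fun t y _ => h1 P t y)]].

Definition A_lim (x : R -> 'rV[R]_n) (u : R -> 'rV[R]_m) : Prop :=
  [/\ W1inf x /\ Linf (U P) u,
      mu.-integrable (half_line R) (fun t => `|phi P t (x t) (u t)|%:E),
      ae_half_line (fun t => differentiable (fun y => phi P t y (u t)) (x t)),
      mu.-integrable (half_line R) (fun t => `|phi_x P t (x t) (u t)|%:E)
    & exists2 gamma : R, 0 < gamma &
      forall delta : R, 0 < delta -> exists2 T : R, 0 < T &
        forall xi xi' : R -> 'rV[R]_n, W1inf xi -> W1inf xi' ->
          (forall t, 0 <= t -> `|xi t - x t| <= gamma) ->
          (forall t, 0 <= t -> `|xi' t - x t| <= gamma) ->
          let rem t := `|phi P t (xi t) (u t) - phi P t (xi' t) (u t)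
                         - (xi t - xi' t) *m (phi_x P t (x t) (u t))^T| in
          mu.-integrable `[T, +oo[%classic (fun t => (rem t)%:E) /\
          (\int[mu]_(t in `[T, +oo[%classic) (rem t)%:E
             <= (delta * sup_norm (fun t => xi t - xi' t))%:E)%E].

Definition hamiltonian (t : R) (y : 'rV[R]_n) (v : 'rV[R]_m) (p : 'rV[R]_n)
    (lambda0 : R) : R :=
  - lambda0 * omega P t * cost P t y v + inner p (phi P t y v).

Definition maximum_principle (x : R -> 'rV[R]_n) (u : R -> 'rV[R]_m)
    (lambda0 : R) (l0 : 'rV[R]_s0) (l1 : 'rV[R]_s1) (p : R -> 'rV[R]_n)
    : Prop :=
  [/\ loc_abs_cont p,
      ae_half_line (fun t => is_derive t (1 : R) p
        (- (p t *m phi_x P t (x t) (u t))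
         + (lambda0 * omega P t) *: cost_x P t (x t) (u t))),
      p 0 = l0 *m jac (h0 P) (x 0),
      exists2 q : 'rV[R]_n,
        l1 *m h1_x P t (x t) @[t --> +oo] --> q & p t @[t --> +oo] --> - q
    & ae_half_line (fun t => U P (u t) /\
        forall v, U P v ->
          hamiltonian t (x t) v (p t) lambda0
            <= hamiltonian t (x t) (u t) (p t) lambda0)].

Definition multipliers_zero (lambda0 : R) (l0 : 'rV[R]_s0) (l1 : 'rV[R]_s1)
    (p : R -> 'rV[R]_n) : Prop :=
  [/\ lambda0 = 0, l0 = 0, l1 = 0 & forall t, 0 <= t -> p t = 0].

End Classes.

(* In [Mixed k x1] the first k coordinates are free at infinity and x1 lists
   the prescribed limits of the remaining n - k coordinates. *)
Inductive endpoint (R : realType) (n : nat) : Type :=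
| Free
| Mixed (k : 'I_n.+1) (x1 : 'rV[R]_(n - k)).

Arguments Free {R n}.
Arguments Mixed {R n} k x1.

Definition tail_ord (n : nat) (k : 'I_n.+1) (j : 'I_(n - k)) : 'I_n :=
  cast_ord (subnKC (leq_ord k)) (rshift k j).

Definition endpoint_dim (R : realType) (n : nat) (e : endpoint R n) : nat :=
  match e with Free => 0 | Mixed k _ => n - k end.

(* With a free endpoint h1 has values in R^0: the condition at infinity is
   void, the multiplier l1 is the only vector of R^0, and l1 *m h1_x = 0. *)
Definition endpoint_h1 (R : realType) (n : nat) (e : endpoint R n)
    : R -> 'rV[R]_n -> 'rV[R]_(endpoint_dim e) :=
  match e return R -> 'rV[R]_n -> 'rV[R]_(endpoint_dim e) with
  | Free => fun _ _ => 0
  | Mixed k x1 => fun _ y => \row_j (y 0 (tail_ord j) - x1 0 j)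
  end.

(* Main.v *)
(* The bounded function x is irrelevant in every coordinate where p tends to 0,
   and p is irrelevant in every coordinate where x - x_* tends to 0 because p
   converges, by transversality.  With a mixed endpoint these two
   cases cover all coordinates: h_1 does not depend on the free coordinates, so
   the limit -h_{1x}^T l_1 of p vanishes there, while all admissible
   trajectories share the prescribed limits of the others. *)
Require Import Defs.
From mathcomp Require Import all_boot all_order all_algebra.
From mathcomp Require Import all_classical all_reals all_analysis.
Set Implicit Arguments.
Unset Strict Implicit.
Unset Printing Implicit Defensive.
Import Order.TTheory GRing.Theory Num.Theory.
Import numFieldNormedType.Exports.
Local Open Scope classical_set_scope.
Local Open Scope ring_scope.

Lemma ler_coord_norm (R : realType) (n : nat) (v : 'rV[R]_n) (i : 'I_n) :
  `|v 0 i| <= `|v|.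
Proof.
rewrite (_ : `|v| = mx_norm v) // mx_normrE.
by apply/bigmax_geP; right; exists (0, i).
Qed.

Lemma cvg_coord (R : realType) (T : Type) (F : set_system T) (n : nat)
    (f : T -> 'rV[R]_n) (l : 'rV[R]_n) (i : 'I_n) {FF : Filter F} :
  f t @[t --> F] --> l -> f t 0 i @[t --> F] --> l 0 i.
Proof.
by move=> fl; exact: (cvg_comp _ _ fl (@coord_continuous R 1 n 0 i l)).
Qed.

Lemma cvgM0_bounded (R : realType) (T : Type) (F : set_system T)
    (f g : T -> R) (M : R) {FF : Filter F} :
  f t @[t --> F] --> 0 -> (\forall t \near F, `|g t| <= M) ->
  f t * g t @[t --> F] --> 0.
Proof.
move=> f0 gM; apply: norm_cvg0.
apply: (@squeeze_cvgr _ _ _ _ (cst 0) (fun t => `|f t| * M)).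
- by apply: filterS gM => t gtM; rewrite normrM mulr_ge0 //= ler_wpM2l.
- exact: cvg_cst.
- by rewrite -[X in _ --> X](mul0r M); apply: cvgMl; exact/norm_cvg0P.
Qed.

Lemma inner_cvg0 (R : realType) (T : Type) (F : set_system T) (n : nat)
    (v w : T -> 'rV[R]_n) {FF : Filter F} :
  (forall i, v t 0 i * w t 0 i @[t --> F] --> 0) ->
  inner (v t) (w t) @[t --> F] --> 0.
Proof.
move=> vw0; have -> : 0 = \sum_(i < n) 0 :> R by rewrite big1.
apply: cvg_big => [|i _]; [exact: add_continuous|exact: vw0].
Qed.

Lemma differentiable_rV (R : realType) (n k : nat)
    (f : 'rV[R]_n -> 'rV[R]_k) (a : 'rV[R]_n) :
  (forall j, differentiable (fun y => f y 0 j) a) -> differentiable f a.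
Proof.
move=> df.
have -> : f = \sum_(j < k) (fun y => f y 0 j *: delta_mx 0 j).
  by apply/funext => y; rewrite fct_sumE [LHS]row_sum_delta.
by apply: differentiable_sum => j; exact: differentiableZl.
Qed.

(** Differentiability identifies row [i] of ['J f a] with the directional derivative along the
    [i]-th basis vector; the difference quotients defining it are all 0, since [f] is constant on
    that line through [a]. *)
Lemma jacobian_row_eq0 (R : realType) (n k : nat)
    (f : 'rV[R]_n -> 'rV[R]_k) (a : 'rV[R]_n) (i : 'I_n) :
  differentiable f a -> (forall c, f (c *: delta_mx 0 i + a) = f a) ->
  row i ('J f a) = 0.
Proof.
move=> df fa; rewrite rowE -deriveEjacobian //.
by rewrite /derive; under eq_fun do rewrite /= fa subrr scaler0; exact: lim_cst.
Qed.

Section MixedEndpoint.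
Context (R : realType) (n : nat) (k : 'I_n.+1) (x1 : 'rV[R]_(n - k)).
Let h1 : R -> 'rV[R]_n -> 'rV[R]_(n - k) := endpoint_h1 (Mixed k x1).

Lemma differentiable_mixed_h1 (t : R) (y : 'rV[R]_n) : differentiable (h1 t) y.
Proof.
apply: differentiable_rV => j; under eq_fun do rewrite mxE.
by apply: differentiableB => //; exact: differentiable_coord.
Qed.

(** [h1] reads only the coordinates [tail_ord j], so column [i] of its usual Jacobian, which is row
    [i] of ['J], vanishes. *)
Lemma mixed_h1_jac_free (l1 : 'rV[R]_(n - k)) (t : R) (y : 'rV[R]_n)
    (i : 'I_n) : (i < k)%N -> (l1 *m jac (h1 t) y) 0 i = 0.
Proof.
move=> ik; have Ji0 : row i ('J (h1 t) y) = 0.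
  apply: jacobian_row_eq0 => [|c]; first exact: differentiable_mixed_h1.
  apply/rowP => j; rewrite !mxE eqxx /=.
  suff /negbTE -> : tail_ord j != i by rewrite mulr0 add0r.
  (* [tail_ord j] has value [k + j], which is at least [k], whereas [i < k]. *)
  by apply: contraTneq ik => <-; rewrite -leqNgt leq_addr.
rewrite mxE big1 // => j _.
by move/rowP/(_ j): Ji0; rewrite !mxE => ->; rewrite mulr0.
Qed.

Lemma mixed_h1_cvg (x : R -> 'rV[R]_n) (j : 'I_(n - k)) :
  h1 t (x t) @[t --> +oo] --> (0 : 'rV[R]_(n - k)) ->
  x t 0 (tail_ord j) @[t --> +oo] --> x1 0 j.
Proof.
move=> /cvg_coord => /(_ j); rewrite mxE.
by under eq_fun do rewrite mxE; move=> /cvg_zero.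
Qed.

End MixedEndpoint.

Theorem lemma4p2 (R : realType) (n m s0 : nat) (e : endpoint R n)
    (P : control_problem R n m s0 (endpoint_dim e))
    (omega_L1 : mu.-integrable (half_line R) (fun t => (omega P t)%:E))
    (omega_gt0 : (0 < \int[mu]_(t in half_line R) `|omega P t|%:E)%E)
    (U_neq0 : U P !=set0)
    (h1E : h1 P = endpoint_h1 e)
    (xs : R -> 'rV[R]_n) (us : R -> 'rV[R]_m)
    (adm : A_adm P xs us) (Lip : A_Lip P xs us) (Lim : A_lim P xs us)
    (opt : strong_local_minimizer P xs us)
    (lambda0 : R) (l0 : 'rV[R]_s0) (l1 : 'rV[R]_(endpoint_dim e))
    (p : R -> 'rV[R]_n)
    (lambda0_ge0 : 0 <= lambda0)
    (nontrivial : ~ multipliers_zero lambda0 l0 l1 p)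
    (PMP : maximum_principle P xs us lambda0 l0 l1 p) :
  (e = Free ->
     p t @[t --> +oo] --> (0 : 'rV[R]_n) /\
     forall x : R -> 'rV[R]_n, W1inf x ->
       inner (p t) (x t) @[t --> +oo] --> (0 : R)) /\
  (forall (k : 'I_n.+1) (x1 : 'rV[R]_(n - k)), e = Mixed k x1 ->
     forall x : R -> 'rV[R]_n, (exists u, A_adm P x u) ->
       inner (p t) (x t - xs t) @[t --> +oo] --> (0 : R)).
Proof.
move: PMP => [_ _ _ [q l1q pq] _]; have pqi i :
    p t 0 i @[t --> +oo] --> (- q) 0 i by exact: cvg_coord.
split=> [e_free|k x1 e_mixed].
  subst e.
  have q0 : q = 0.
    apply: (cvg_unique _ l1q) => //.
    (* Here [l1] lies in R^0, so [q] is the limit of the zero function. *)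
    have -> : l1 = 0 by exact: thinmx0.
    by rewrite /=; under eq_fun do rewrite mul0mx; exact: cvg_cst.
  split=> [|x [[M xM] _ _]]; first by rewrite -oppr0 -q0.
  apply: inner_cvg0 => i; apply: (cvgM0_bounded (M := M)).
    by have := pqi i; rewrite q0 oppr0 mxE.
  near=> t; apply: le_trans (ler_coord_norm _ _) (xM _ _).
  by near: t; exact: nbhs_pinfty_ge.
subst e => x [u [[[[M xM] _ _] _] _ _ h1x _]].
move: adm => [[[[Ms xsM] _ _] _] _ _ h1xs _].
rewrite h1E in h1x h1xs.
apply: inner_cvg0 => i; have [ik|ki] := ltnP i k.
  (* Free coordinate: [M] bounds [x] and [Ms] bounds [xs] on the half-line, so it remains to show
     that coordinate [i] of [p] tends to 0. *)
  apply: (cvgM0_bounded (M := M + Ms)).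
    have := pqi i; rewrite mxE.
    suff -> : q 0 i = 0 by rewrite oppr0.
    have qi : (l1 *m h1_x P t (xs t)) 0 i @[t --> +oo] --> q 0 i
      by exact: cvg_coord.
    apply: (cvg_unique _ qi) => //=.
    under eq_fun do rewrite /h1_x h1E mixed_h1_jac_free //.
    exact: cvg_cst.
  near=> t; have t0 : 0 <= t by near: t; exact: nbhs_pinfty_ge.
  apply: le_trans (ler_coord_norm _ _) _; apply: le_trans (ler_normB _ _) _.
  by apply: lerD; [exact: xM|exact: xsM].
(* Prescribed coordinate: [i] is the tail coordinate of rank [i - k]. *)
have jP : (i - k < n - k)%N by rewrite ltn_sub2r // (leq_ltn_trans ki).
have -> : i = tail_ord (Ordinal jP) by apply: val_inj; rewrite /= subnKC.
(* This coordinate of [p] may have a nonzero limit; the product tends to that limit times 0. *)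
rewrite -[X in _ --> X](mulr0 ((- q) 0 (tail_ord (Ordinal jP)))).
apply: cvgM; first exact: pqi.
(* Both trajectories are admissible, so this coordinate of each tends to the same entry of [x1]. *)
rewrite -(subrr (x1 0 (Ordinal jP))); under eq_fun do rewrite !mxE.
by apply: cvgB; exact: mixed_h1_cvg.
Unshelve. all: by end_near.
Qed.
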